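(* Let $(S,+)$ be a Clifford semigroup and let $\mathfrak{R}$ be a commutative Rota--Baxter endomorphism of $(S,+)$. Then the weak brace $S_{\mathfrak{R}}=(S,+,\circ)$, where $a\circ b:=a+\mathfrak{R}(a)+b-\mathfrak{R}(a)$ for all $a,b\in S$, is a bi-weak brace.
   Context: A Clifford semigroup is an inverse semigroup with central idempotents. It is written additively (not assumed commutative): $-a$ is the inverse of $a$, $a-b:=a+(-b)$, and $a^0:=a-a=-a+a$. A Rota--Baxter operator on a Clifford semigroup $(S,+)$ is a map $\mathfrak{R}:S\to S$ such that, for all $a,b\in S$, $\mathfrak{R}(a)+\mathfrak{R}(b)=\mathfrak{R}(a+\mathfrak{R}(a)+b-\mathfrak{R}(a))$ and $a+\mathfrak{R}(a)^0=a$. A commutative Rota--Baxter endomorphism of $(S,+)$ is an endomorphism of $(S,+)$ that is a Rota--Baxter operator and whose image is commutative. A weak brace is a triple $(S,+,\circ)$ such that $(S,+)$ and $(S,\circ)$ are inverse semigroups and, for all $a,b,c\in S$, $a\circ(b+c)=a\circ b-a+a\circ c$ and $a\circ a^-=-a+a$, where $-a$ and $a^-$ are the inverses of $a$ in $(S,+)$ and $(S,\circ)$ respectively, and $\circ$ has higher precedence than $+$. For every Rota--Baxter operator $\mathfrak{R}$ on a Clifford semigroup $(S,+)$, the triple $S_{\mathfrak R}=(S,+,\circ)$ with $a\circ b:=a+\mathfrak{R}(a)+b-\mathfrak{R}(a)$ is a weak brace. A weak brace $(S,+,\circ)$ is a bi-weak brace if $(S,\circ,+)$ is also a weak brace, i.e.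 if $a+(b\circ c)=(a+b)\circ a^-\circ(a+c)$ and $a-a=a^-\circ a$ for all $a,b,c\in S$. *)

(* Defs.v *)
From mathcomp Require Import all_boot.
Set Implicit Arguments.
Unset Strict Implicit.
Unset Printing Implicit Defensive.

(* Structures on a carrier [S : Type] are
   predicates on explicit operations, since a brace puts two semigroup
   structures on the same carrier and neither is commutative. *)

Definition inverse_of (S : Type) (op : S -> S -> S) (a b : S) : Prop :=
  op (op a b) a = a /\ op (op b a) b = b.

(* [inv] is not additional structure: the last field makes it the unique
   inverse map of [op]. *)
Record inverse_semigroup (S : Type) (op : S -> S -> S) (inv : S -> S) : Prop :=
  InverseSemigroup {
    isg_assoc : associative op;
    isg_inv : forall a, inverse_of op a (inv a);
    isg_inv_unique : forall a b, inverse_of op a b -> b = inv a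
  }.

Record clifford_semigroup (S : Type) (op : S -> S -> S) (inv : S -> S) : Prop :=
  CliffordSemigroup {
    clifford_isg : inverse_semigroup op inv;
    clifford_idem_central : forall e a, op e e = e -> op e a = op a e
  }.

Section RotaBaxter.
Context (S : Type) (add : S -> S -> S) (neg : S -> S).
Local Notation "a + b" := (add a b).
Local Notation "a - b" := (add a (neg b)).

Record rota_baxter (R : S -> S) : Prop := RotaBaxter {
  rb_eq : forall a b, R a + R b = R (a + R a + b - R a);
  rb_zero : forall a, a + (R a - R a) = a
}.

Record commutative_rota_baxter_endo (R : S -> S) : Prop :=
  CommutativeRotaBaxterEndo {
    crbe_morph : {morph R : a b / a + b};
    crbe_rb : rota_baxter R;
    crbe_im_comm : forall a b, R a + R b = R b + R a
  }.

Definition rb_circ (R : S -> S) (a b : S) : S := a + R a + b - R a.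

End RotaBaxter.

Section WeakBrace.
Context (S : Type).

Section Laws.
Context (add : S -> S -> S) (neg : S -> S) (circ : S -> S -> S) (inv : S -> S).
Local Notation "a + b" := (add a b).
Local Notation "- a" := (neg a).
Local Notation "a - b" := (add a (neg b)).
Local Notation "a ∘ b" := (circ a b) (at level 40, left associativity).

Record weak_brace_laws : Prop := WeakBraceLaws {
  wb_add : inverse_semigroup add neg;
  wb_circ : inverse_semigroup circ inv;
  wb_distr : forall a b c, a ∘ (b + c) = a ∘ b - a + a ∘ c;
  wb_inv : forall a, a ∘ inv a = - a + a
}.

End Laws.

(* The witnesses are unique, by [isg_inv_unique]. *)
Definition weak_brace (add circ : S -> S -> S) : Prop :=
  exists neg inv : S -> S, weak_brace_laws add neg circ inv.

Definition bi_weak_brace (add circ : S -> S -> S) : Prop :=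
  weak_brace add circ /\ weak_brace circ add.

End WeakBrace.

(* Main.v *)
(* The circle operation has the same idempotents as [add], they stay central,
   and on both sides the idempotent attached to [a] is [a - a]; the circle
   inverse of [a] is [- R a - a + R a]. Since [R] is additive with commutative
   image, [R (a ∘ b) = R a + R b], so every conjugating factor [R a] either
   cancels or leaves an idempotent [R a - R a], which is absorbed by [a]. *)
Require Import Defs.
From mathcomp Require Import all_boot.

Set Implicit Arguments.
Unset Strict Implicit.

Section Clifford.
Context (S : Type) (add : S -> S -> S) (neg : S -> S).
Local Notation "a + b" := (add a b).
Local Notation "- a" := (neg a).
Local Notation "a - b" := (add a (neg b)).

(** Central idempotents force uniqueness: any inverse [b] of [a] and [- a] itself both equal
    [- a + a + b]. For the circle operation only regularity then has to be checked. *)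
Lemma clifford_of_regular :
  associative add -> (forall a, inverse_of add a (- a)) ->
  (forall e a, e + e = e -> e + a = a + e) -> clifford_semigroup add neg.
Proof.
move=> addA addV idC; split=> //; split=> // a b [aba bab].
have [ana nan] := addV a.
have ba_id : b + a + (b + a) = b + a by rewrite addA bab.
have an_id : a - a + (a - a) = a - a by rewrite addA ana.
have b_eq : b = - a + a + b.
  have E : b = b + a + (- a + a) + b by rewrite -{1}bab -{1}ana !addA.
  by rewrite {1}E (idC _ _ ba_id) -!addA [b + (a + b)]addA bab.
have n_eq : - a = - a + a + b.
  have E : - a = - a + (a + b + (a - a)) by rewrite [a + b + _]addA aba addA nan.
  by rewrite {1}E -(idC _ _ an_id) !addA nan.
by rewrite b_eq -n_eq.
Qed.

Hypothesis cS : clifford_semigroup add neg.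

Let addA : associative add. Proof. exact: isg_assoc (clifford_isg cS). Qed.

Lemma clifford_addKV a : a - a + a = a.
Proof. by case: (isg_inv (clifford_isg cS) a). Qed.

Lemma clifford_addVK a : - a + a - a = - a.
Proof. by case: (isg_inv (clifford_isg cS) a). Qed.

Lemma clifford_oppK a : - - a = a.
Proof.
symmetry; apply: isg_inv_unique (clifford_isg cS) _ _ _.
by split; [exact: clifford_addVK | exact: clifford_addKV].
Qed.

Lemma clifford_zeroC a x : a - a + x = x + (a - a).
Proof. by apply: clifford_idem_central cS _ _ _; rewrite addA clifford_addKV. Qed.

Lemma clifford_addr0 a : a + a - a = a.
Proof. by rewrite -addA -clifford_zeroC clifford_addKV. Qed.

Lemma clifford_addV a : - a + a = a - a.
Proof.
have zeroVC x : - a + a + x = x + (- a + a).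
  by have := clifford_zeroC (- a) x; rewrite clifford_oppK.
transitivity (a - a + (- a + a)).
  by rewrite -{1}(clifford_addVK a) -[- a + a - a]addA -clifford_zeroC !addA.
by rewrite -zeroVC addA zeroVC addA clifford_addKV.
Qed.

(** Sums are kept left-associated: a central pair [a - a] is pushed to the right until it stands
    where an absorption lemma removes it. *)
Lemma clifford_addrKC x a y : x + a - a + y = x + y + a - a.
Proof. by rewrite -!addA; congr (_ + _); rewrite addA clifford_zeroC. Qed.

Lemma clifford_addrVK x a : x - a + a = x + a - a.
Proof. by rewrite -!addA clifford_addV. Qed.

Lemma clifford_addrK x a : x + a + a - a = x + a.
Proof. by rewrite -addA -addA [a + _]addA clifford_addr0. Qed.

Lemma clifford_addrNK x a : x - a + a - a = x - a.
Proof. by rewrite -!addA [- a + _]addA clifford_addVK. Qed.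

Lemma clifford_addrKN x a : x + a - a - a = x - a.
Proof. by rewrite -clifford_addrVK clifford_addrNK. Qed.

Lemma clifford_absorb x a y : x + a + y + a - a = x + a + y.
Proof. by rewrite -clifford_addrKC clifford_addrK. Qed.

Lemma clifford_absorbN x a y : x - a + y + a - a = x - a + y.
Proof. by rewrite -clifford_addrKC clifford_addrNK. Qed.

Lemma clifford_absorb0 a y : a + y + a - a = a + y.
Proof. by rewrite -clifford_addrKC clifford_addr0. Qed.

Lemma clifford_oppD a b : - (a + b) = - b - a.
Proof.
symmetry; apply: isg_inv_unique (clifford_isg cS) _ _ _; split; rewrite !addA.
  rewrite clifford_addrVK (clifford_addrKC _ a b) clifford_addrVK clifford_addrK.
  exact: clifford_absorb0.
rewrite clifford_addrVK (clifford_addrKC _ a b) (clifford_addrKC _ a (- b)).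
by rewrite clifford_addVK clifford_addrKN.
Qed.
End Clifford.

Section CommutativeRotaBaxterEndo.
Context (S : Type) (add : S -> S -> S) (neg : S -> S) (R : S -> S).
Hypotheses (cS : clifford_semigroup add neg)
           (rbR : commutative_rota_baxter_endo add neg R).
Local Notation "a + b" := (add a b).
Local Notation "- a" := (neg a).
Local Notation "a - b" := (add a (neg b)).
Local Notation "a ∘ b" := (rb_circ add neg R a b) (at level 40, left associativity).

Let addA : associative add. Proof. exact: isg_assoc (clifford_isg cS). Qed.
Let RD : {morph R : a b / a + b}. Proof. exact: crbe_morph rbR. Qed.
Let RC a b : R a + R b = R b + R a. Proof. exact: crbe_im_comm rbR a b. Qed.
Let addKV := clifford_addKV cS.
Let addVK := clifford_addVK cS.
Let oppK := clifford_oppK cS.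
Let zeroC := clifford_zeroC cS.
Let addV := clifford_addV cS.
Let addrKC := clifford_addrKC cS.
Let addrVK := clifford_addrVK cS.
Let addrK := clifford_addrK cS.
Let absorb := clifford_absorb cS.
Let absorb0 := clifford_absorb0 cS.
Let oppD := clifford_oppD cS.

Lemma rb_opp a : R (- a) = - R a.
Proof.
apply: isg_inv_unique (clifford_isg cS) _ _ _.
by split; rewrite -!RD ?addKV ?addVK.
Qed.

Lemma rb_addr0 a : a + R a - R a = a.
Proof. by rewrite -addA (rb_zero (crbe_rb rbR)). Qed.

Lemma rb_addrN0 a : - a + R a - R a = - a.
Proof. by rewrite -addrVK -{2}(oppK (R a)) -rb_opp rb_addr0. Qed.

Lemma rb_addrK x a : x + a + R a - R a = x + a.
Proof. by rewrite -!addA [a + _]addA rb_addr0. Qed.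

Lemma rb_addrNK x a : x - a + R a - R a = x - a.
Proof. by rewrite -!addA [- a + _]addA rb_addrN0. Qed.

Lemma rb_absorb x a y : x + a + y + R a - R a = x + a + y.
Proof. by rewrite -addrKC rb_addrK. Qed.

Lemma rb_absorb0 a y : a + y + R a - R a = a + y.
Proof. by rewrite -addrKC rb_addr0. Qed.

Lemma rb_circE a b : a ∘ b = a + R a + b - R a.
Proof. by []. Qed.

Lemma rb_circ_morph a b : R (a ∘ b) = R a + R b.
Proof. by rewrite (rb_eq (crbe_rb rbR)). Qed.

(** Once expanded, the two sides differ by an inner [- R a + R a], absorbed by the earlier [R a]. *)
Lemma rb_circA : associative (rb_circ add neg R).
Proof.
move=> a b c; rewrite (rb_circE (a ∘ b)) rb_circ_morph /rb_circ oppD !addA.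
by rewrite addrVK absorb.
Qed.

Definition rb_circ_inv a := - R a - a + R a.

(** Commutativity of the image brings the two [R (R a)] terms together; [- R a] absorbs the
    resulting idempotent, by [rb_zero] at [R a]. *)
Lemma rb_circ_inv_morph a : R (rb_circ_inv a) = - R a.
Proof. by rewrite !RD [R (- R a) + _]RC !rb_opp addrVK rb_addrN0. Qed.

Lemma rb_circV a : a ∘ rb_circ_inv a = a - a.
Proof. by rewrite /rb_circ /rb_circ_inv !addA rb_addr0 rb_addrNK. Qed.

Lemma rb_circVr a : rb_circ_inv a ∘ a = a - a.
Proof.
rewrite /rb_circ rb_circ_inv_morph oppK /rb_circ_inv rb_addrNK addrVK addrKC.
by rewrite addV -[_ + a - a]addA zeroC addA rb_addrNK.
Qed.

Lemma rb_circ_idl e a : e + e = e -> e ∘ a = e + a.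
Proof.
move=> ee; have Re : R e + R e = R e by rewrite -RD ee.
by rewrite /rb_circ -(addA e) (clifford_idem_central cS _ Re) addA rb_absorb0.
Qed.

Lemma rb_circ_idr e a : e + e = e -> a ∘ e = a + e.
Proof.
move=> ee.
by rewrite /rb_circ -(addA a) -(clifford_idem_central cS _ ee) addA rb_absorb0.
Qed.

(** [R e] is an additive idempotent before [e] is known to be one; its centrality reduces [e ∘ e] to
    [e + e]. *)
Lemma rb_circ_idem e : e ∘ e = e -> e + e = e.
Proof.
move=> ee; have Re : R e + R e = R e by rewrite -rb_circ_morph ee.
rewrite -[RHS]ee /rb_circ -(addA e (R e)) (clifford_idem_central cS _ Re) addA.
by rewrite rb_addrK.
Qed.

Lemma rb_circ_clifford : clifford_semigroup (rb_circ add neg R) rb_circ_inv.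
Proof.
have a0a0 a : a - a + (a - a) = a - a by rewrite addA addKV.
apply: clifford_of_regular; first exact: rb_circA.
(* The inner circle product is the idempotent [a - a], so the outer one is an ordinary sum. *)
- move=> a; split; first by rewrite rb_circV rb_circ_idl.
  rewrite rb_circVr rb_circ_idl // zeroC addA /rb_circ_inv.
  exact: clifford_absorbN cS _ _ _.
- move=> e a /rb_circ_idem ee.
  by rewrite rb_circ_idl // rb_circ_idr // (clifford_idem_central cS _ ee).
Qed.

(** The middle block [- R a - a + a + R a] on the right is a sum of two idempotents, absorbed by the
    leading [a] and [R a]. *)
Lemma rb_circDr a b c : a ∘ (b + c) = a ∘ b - a + a ∘ c.
Proof.
rewrite /rb_circ !addA addrVK (addrKC _ a (R a)) addrVK absorb.
by rewrite -(addA a (R a) b) absorb0.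
Qed.

Lemma rb_add_circr a b c :
  a + b ∘ c = (a + b) ∘ rb_circ_inv a ∘ (a + c).
Proof.
(* Writing [R (a + b)] as [R b + R a] lets [R a] meet the [- R a] that opens [rb_circ_inv a], so
   only the conjugation by [R b] survives. *)
have E : (a + b) ∘ rb_circ_inv a = a + b + R b - a - R b.
  rewrite /rb_circ /rb_circ_inv RD RC oppD !addA (addrKC _ (R a) (- a)).
  by rewrite !rb_addrNK.
(* The left factor has image [R b + R a - R a], so it again conjugates by [R b]; its [R b] meets the
   final [- R b] of [E], then [- a] meets [a]. *)
rewrite (rb_circE (_ ∘ _)) rb_circ_morph rb_circ_inv_morph E RD RC /rb_circ.
rewrite !oppD oppK !addA (addrKC _ (R a) a) rb_addrK rb_absorb.
rewrite addrVK (addrKC _ (R b) a) addrVK.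
by rewrite -(addA a b) absorb0 addA addrK.
Qed.

End CommutativeRotaBaxterEndo.

Theorem proposition17 (S : Type) (add : S -> S -> S) (neg : S -> S)
    (hS : clifford_semigroup add neg) (R : S -> S)
    (hR : commutative_rota_baxter_endo add neg R) :
  bi_weak_brace add (rb_circ add neg R).
Proof.
have isg_add := clifford_isg hS.
have isg_circ := clifford_isg (rb_circ_clifford hS hR).
split; [exists neg, (rb_circ_inv add neg R) | exists (rb_circ_inv add neg R), neg].
  split=> // [a b c|a]; first exact: rb_circDr.
  by rewrite (rb_circV hS hR) (clifford_addV hS).
split=> // [a b c|a]; first exact: rb_add_circr.
(* With the operations exchanged, the law [wb_inv] reads [a - a = rb_circ_inv a ∘ a]. *)
by rewrite (rb_circVr hS hR).
Qed.
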